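(* Let $G$ be a connected graph such that the point-shadow $v/u=\{x\in V(G): v\in\langle\{x,u\}\rangle\}$ is geodesically convex for any two adjacent vertices $u,v$ of $G$. Then $G$ is a smooth graph.
   Context: Graphs are simple and undirected; $d$ denotes the shortest path distance of a connected graph $G$. Intervals: $I[u,v]=\{w\in V(G): d(u,w)+d(w,v)=d(u,v)\}$; $N(u)=\{w: d(u,w)=1\}$; the step system (step function) of $G$ is $S(u,v)=I[u,v]\cap N(u)$. A connected graph $G$ is smooth if for all vertices $u,v,w,x,y$: $v\in S(u,w)$, $v\in S(u,y)$ and $x\in S(w,y)$ imply $v\in S(u,x)$. A set $A\subseteq V(G)$ is geodesically convex if $I[a,b]\subseteq A$ for all $a,b\in A$; $\langle W\rangle$ denotes the smallest geodesically convex set containing $W\subseteq V(G)$. *)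

(* Defs.v *)
From mathcomp Require Import all_boot.
From mathcomp Require Import boolp classical_sets.

Set Implicit Arguments.
Unset Strict Implicit.
Unset Printing Implicit Defensive.

Local Open Scope classical_set_scope.

(* A simple undirected graph, finite or infinite, is a symmetric irreflexive  *)
(* relation e on its type of vertices V. The definitions make sense for any   *)
(* e; symmetry, irreflexivity and connectedness are assumed where needed.     *)
Section Graph.
Variables (V : Type) (e : rel V).
Implicit Types (u v w x y : V) (A W : set V).

Definition walk_lengths u v : set nat :=
  [set n | exists p : seq V, [/\ path e u p, last u p = v & size p = n]].

Definition graph_connected : Prop := forall u v, walk_lengths u v !=set0.

(* The least length of a walk from u to v; the default value 0 is only taken  *)
(* when there is no such walk, which does not happen in a connected graph.    *)
Definition dist u v : nat :=
  xget 0 [set n | walk_lengths u v n /\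
                  forall m, walk_lengths u v m -> n <= m].

Definition interval u v : set V :=
  [set w | dist u w + dist w v = dist u v].

Definition neighborhood u : set V := [set w | dist u w = 1].

Definition step u v : set V := interval u v `&` neighborhood u.

Definition smooth : Prop := forall u v w x y,
  step u w v -> step u y v -> step w y x -> step u x v.

Definition geodesically_convex A : Prop :=
  forall a b, A a -> A b -> interval a b `<=` A.

(* [smallest C W] is the intersection of the sets satisfying C and            *)
(* containing W; geodesic convexity is stable under intersection.             *)
Definition geodesic_hull W : set V := smallest geodesically_convex W.

(* The point-shadow v/u. *)
Definition point_shadow v u : set V :=
  [set x | geodesic_hull [set x; u] v].

End Graph.

(* Main.v *)
Require Import Defs.
From mathcomp Require Import all_boot.
From mathcomp Require Import boolp classical_sets.
From mathcomp Require Import zify.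

(** The theorem follows from one fact about a graph with convex point-shadows:
    the hull of [x] and [u] contains no neighbour of [u] outside the interval
    between [x] and [u] (lemma [hull_neighbor_interval]). Given this fact, if
    [v] lies in [step u w] and in [step u y], then [w] and [y] lie in the
    shadow [v/u], which is convex and hence contains every point [x] of the
    interval between [w] and [y]; so [v] lies in the hull of [x] and [u], hence
    in the interval, that is, in [step u x].

    The intervals themselves need not be convex, so the fact is proved by
    strong induction on the distance between [x] and [u], as follows. Let [v] be
    a neighbour of [u] in the hull of [x] and [u] that is not in the interval.
    Since [v/u] is convex and contains [x] and [v] but not [u], the point [u] is
    not between [x] and [v]; as [v] is not between [x] and [u] either, the
    distances [d x v] and [d x u] are equal. The induction hypothesis then
    shows that every point of the interval other than [x] lies in the opposite
    shadow [u/v] (lemma [interval_opposite_shadow]). The same holds with [x] and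
    [u] exchanged. Hence the hull [C] of the interior of the interval avoids
    every such [v], and a geodesic from [u] to a point of [C] cannot start with
    such a [v], because [u/v] and [v/u] are disjoint. So it starts in the
    interval and stays in [C] until it ends. The same is true at [x], and thus
    adding [x] and [u] to [C] gives a convex set, which is the whole hull of
    [x] and [u] (lemma [hull_sub_interior]). *)

Set Implicit Arguments.
Unset Strict Implicit.
Unset Printing Implicit Defensive.

Local Open Scope classical_set_scope.

(** * Convexity in an arbitrary relation *)

Section Hull.
Variables (V : Type) (e : rel V).
Implicit Types (u v w x : V) (A W : set V).

Notation hull := (geodesic_hull e).

Lemma hull_convex W : geodesically_convex e (hull W).
Proof.
move=> a b ha hb z hz M [convM subM].
by apply: (convM a b) => //; [apply: ha | apply: hb].
Qed.

Lemma sub_hull W : W `<=` hull W.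
Proof. exact: sub_gen_smallest. Qed.

Lemma hull_sub W A : geodesically_convex e A -> W `<=` A -> hull W `<=` A.
Proof. exact: smallest_sub. Qed.

Lemma hull2_sub x u A : geodesically_convex e A -> A x -> A u ->
  hull [set x; u] `<=` A.
Proof. by move=> convA Ax Au; apply: hull_sub => // z [->|->]. Qed.

Lemma hull2_left x u : hull [set x; u] x.
Proof. by apply: sub_hull; left. Qed.

Lemma hull2_right x u : hull [set x; u] u.
Proof. by apply: sub_hull; right. Qed.

Lemma interval_hull x u : interval e x u `<=` hull [set x; u].
Proof. by apply: hull_convex; [exact: hull2_left | exact: hull2_right]. Qed.

Lemma point_shadow_self u v : point_shadow e v u v.
Proof. exact: hull2_left. Qed.

End Hull.

(** * The metric of a connected graph *)

Section Metric.
Variables (V : Type) (e : rel V).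
Hypothesis e_conn : graph_connected e.
Implicit Types (u v w x z : V).

Notation d := (dist e).
Notation hull := (geodesic_hull e).

Lemma distP u v : walk_lengths e u v (d u v) /\
  forall m, walk_lengths e u v m -> d u v <= m.
Proof.
have [n0 hn0] := e_conn u v.
have exn : exists n, `[< walk_lengths e u v n >] by exists n0; apply/asboolP.
case: (ex_minnP exn) => n /asboolP hn hmin.
apply: (@xgetPex _ 0 [set n | walk_lengths e u v n /\
  forall m, walk_lengths e u v m -> n <= m]).
by exists n; split=> // m hm; apply/hmin/asboolP.
Qed.

Lemma dist_path u p : path e u p -> d u (last u p) <= size p.
Proof. by move=> hp; apply: (distP _ _).2; exists p. Qed.

Lemma distxx u : d u u = 0.
Proof. by have := @dist_path u [::] isT; rewrite leqn0 => /eqP. Qed.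

Lemma dist_eq0 u v : d u v = 0 -> u = v.
Proof. by move=> h; have [[[|w p] [_ //]] _] := distP u v; rewrite h. Qed.

Lemma dist_triangle u v w : d u w <= d u v + d v w.
Proof.
have [[p [hp <- <-]] _] := distP u v.
have [[q [hq <- <-]] _] := distP (last u p) w.
rewrite -size_cat -last_cat; apply: dist_path.
by rewrite cat_path hp.
Qed.

Lemma dist_first u v : u <> v -> exists w, e u w /\ (d w v).+1 = d u v.
Proof.
move=> uv; have [[[|w p] /= [hp hl hs]] _] := distP u v; first by case: uv.
have {hp} [uw hp] := andP hp.
exists w; split=> //.
have := dist_path hp; rewrite hl.
have := @dist_path u [:: w]; rewrite /= uw => /(_ isT) h1.
have := dist_triangle u w v; lia.
Qed.

Lemma interval_xx u z : interval e u u z -> z = u.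
Proof. by rewrite /interval /= distxx => h; apply/esym/dist_eq0; lia. Qed.

Lemma hull_xx u z : hull [set u; u] z -> z = u.
Proof.
move=> h; apply: (@hull2_sub _ e u u [set u]) h => // a b -> ->.
exact: interval_xx.
Qed.

Hypotheses (e_sym : symmetric e) (e_irr : irreflexive e).

Lemma edge_neq u v : e u v -> u <> v.
Proof. by move=> uv euv; move: uv; rewrite euv e_irr. Qed.

Lemma dist_edge u v : e u v -> d u v = 1.
Proof.
move=> uv; have := @dist_path u [:: v]; rewrite /= uv => /(_ isT).
have := @dist_eq0 u v; have := edge_neq uv.
by case: (d u v) => [|[]] // ne /(_ erefl).
Qed.

Lemma edge_dist1 u v : d u v = 1 -> e u v.
Proof.
move=> h; have uv : u <> v by move=> euv; rewrite euv distxx in h.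
have [w [uw]] := dist_first uv; rewrite h => -[] /dist_eq0 <- //.
Qed.

Lemma distC u v : d u v = d v u.
Proof.
suff le a b : d a b <= d b a by apply/eqP; rewrite eqn_leq !le.
elim: {b}_.+1 {-2}b (ltnSn (d b a)) => // n IH b lt_n.
have [->|ba] := pselect (b = a); first by rewrite distxx.
have [c [bc hc]] := dist_first ba.
have := IH c; have := dist_triangle a c b.
rewrite e_sym in bc; rewrite (dist_edge bc); lia.
Qed.

Lemma intervalC u v : interval e u v = interval e v u.
Proof.
by apply/seteqP; split=> z;
  rewrite /interval /= addnC ![d z _]distC ![d _ z]distC (distC u v).
Qed.

End Metric.

(** * Hulls of pairs when point-shadows are convex *)

Section Shadows.
Variables (V : Type) (e : rel V).
Hypotheses (e_sym : symmetric e) (e_irr : irreflexive e).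
Hypothesis e_conn : graph_connected e.
Hypothesis shadow_convex : forall u v : V, e u v ->
  geodesically_convex e (point_shadow e v u).
Implicit Types (u v w x z : V).

Notation d := (dist e).
Notation hull := (geodesic_hull e).

Let distC := distC e_conn e_sym e_irr.
Let dist_edge := dist_edge e_conn e_irr.
Let edge_dist1 := edge_dist1 e_conn.

Lemma point_shadowN u v : e u v -> ~ point_shadow e v u u.
Proof. by move=> /(edge_neq e_irr) uv /(hull_xx e_conn) /esym. Qed.

(** If [z] were in both shadows, then [v/u] would contain [z] and [v], hence
    also their hull, and so [u]. *)
Lemma opposite_shadows_disjoint u v z : e u v ->
  point_shadow e v u z -> ~ point_shadow e u v z.
Proof.
move=> uv hz huz; apply: (point_shadowN uv).
exact: (hull2_sub (shadow_convex uv) hz (@point_shadow_self _ _ _ _) huz).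
Qed.

Definition hull_neighbors_between x u : Prop :=
  forall v, e u v -> hull [set x; u] v -> interval e x u v.

Definition interior x u : set V :=
  [set z | [/\ interval e x u z, z <> x & z <> u]].

(** A point [z] of the interval is in [u/v] as soon as it is nearer to [u] than
    to [v]. If it is not, then it is between [x] and [v], hence in [v/u]. Its
    distance to [u] is less than that of [x], so by the induction hypothesis [v]
    would be between [z] and [u], and then also between [x] and [u]. *)
Lemma interval_opposite_shadow x u v :
  (forall z, d z u < d x u -> hull_neighbors_between z u) ->
  e u v -> hull [set x; u] v -> ~ interval e x u v ->
  forall z, interval e x u z -> z <> x -> point_shadow e u v z.
Proof.
move=> IH uv hv nIv z Iz zx.
have subv : interval e x v `<=` point_shadow e v u.
  exact: shadow_convex uv _ _ hv (@point_shadow_self _ _ _ _).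
have nu : ~ interval e x v u by move=> /subv; apply: point_shadowN.
have duv := dist_edge uv.
have dvu : d v u = 1 by rewrite distC.
have xz : d x z <> 0 by move=> /(dist_eq0 e_conn) /esym.
move: Iz nIv nu; rewrite /interval /= => Iz nIv nu.
have t1 := dist_triangle e_conn x v u.
have t2 := dist_triangle e_conn x u v.
have t3 := dist_triangle e_conn x z v.
have t4 := dist_triangle e_conn z u v.
have [far|near] := ltnP (d z u) (d z v).
  by apply: interval_hull; rewrite /interval /=; lia.
(* Here d x v = d x u and d z v = d z u, so z is between x and v. *)
have hz : point_shadow e v u z by apply: subv; rewrite /interval /=; lia.
have zlt : d z u < d x u by lia.
have := IH z zlt v uv hz; rewrite /interval /=; lia.
Qed.

Lemma hull_interior_shadow x u v :
  (forall z, d z u < d x u -> hull_neighbors_between z u) ->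
  e u v -> hull [set x; u] v -> ~ interval e x u v ->
  hull (interior x u) `<=` point_shadow e u v.
Proof.
move=> IH uv hv nIv; apply: hull_sub.
  by apply: shadow_convex; rewrite e_sym.
by move=> z [Iz zx _]; apply: (interval_opposite_shadow IH uv hv nIv).
Qed.

Lemma hull_interior_sub x u : hull (interior x u) `<=` hull [set x; u].
Proof.
apply: hull_sub; first exact: hull_convex.
by move=> z [Iz _ _]; exact: interval_hull.
Qed.

Lemma hull_interior_edge0 x u z : e u x -> ~ hull (interior x u) z.
Proof.
move=> ux hz; suff: set0 z by [].
apply: hull_sub hz; first by [].
move=> p [Ip px pu].
rewrite e_sym in ux; move: Ip; rewrite /interval /= (dist_edge ux) => Ip.
have p1 : d x p <> 0 by move=> /(dist_eq0 e_conn) /esym.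
have p2 : d p u <> 0 by move=> /(dist_eq0 e_conn).
lia.
Qed.

(** A geodesic from [u] to a point [z] of the hull [C] of the interior starts
    with a neighbour [w] of [u]. If [w] is in the interval between [x] and [u],
    it is in [C], and so is the rest of the geodesic. Otherwise [C], and with it
    [z], lies in [u/w]; but [z] lies in [w/u], as [w] is between [z] and [u]. *)
Lemma interval_end_interior x u z :
  (forall z, d z u < d x u -> hull_neighbors_between z u) ->
  hull (interior x u) z ->
  interval e u z `<=` hull (interior x u) `|` [set u].
Proof.
move=> IH hz p Ip; have [->|/nesym pu] := pselect (p = u); first by right.
left; have [w [uw hw]] := dist_first e_conn pu.
have duw := dist_edge uw.
have t1 := dist_triangle e_conn u w z.
have t2 := dist_triangle e_conn w p z.
move: Ip; rewrite /interval /= => Ip.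
have Iw : interval e u z w by rewrite /interval /=; lia.
have hullw : hull [set x; u] w.
  apply: hull_convex Iw; [exact: hull2_right | exact: hull_interior_sub].
have [Iwx|nIwx] := pselect (interval e x u w).
  apply: (@hull_convex _ e _ w z) => //; last by rewrite /interval /=; lia.
  apply: sub_hull; split=> //; last by apply/nesym/(edge_neq e_irr).
  by move=> wx; apply: (@hull_interior_edge0 x u z) hz; rewrite -wx.
case: (@opposite_shadows_disjoint u w z uw).
  rewrite intervalC // in Iw; exact: interval_hull.
exact: (hull_interior_shadow IH uw hullw nIwx).
Qed.

Lemma interiorC x u : interior x u = interior u x.
Proof.
by apply/seteqP; split=> z [Iz zx zu]; split=> //; rewrite intervalC.
Qed.

(** The right-hand side is convex: [interval_end_interior] applies at both ends,
    since [interior] is symmetric in [x] and [u]. *)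
Lemma hull_sub_interior x u :
  (forall y t, d y t < d x u -> hull_neighbors_between y t) ->
  hull [set x; u] `<=` hull (interior x u) `|` [set x; u].
Proof.
move=> IH; set C := hull (interior x u).
have endu z : C z -> interval e u z `<=` C `|` [set x; u].
  move=> Cz p /(@interval_end_interior x u z) [] //; last by move=> ->; right; right.
    by move=> y; apply: IH.
  by left.
have endx z : C z -> interval e x z `<=` C `|` [set x; u].
  rewrite /C interiorC => Cz p /(@interval_end_interior u x z) [] //.
  - by move=> y; rewrite (distC u); apply: IH.
  - by left.
  - by move=> ->; right; left.
have Ixu : interval e x u `<=` C `|` [set x; u].
  move=> z Iz; have [->|zx] := pselect (z = x); first by right; left.
  have [->|zu] := pselect (z = u); first by right; right.
  by left; apply: sub_hull.
apply: hull2_sub; [|by right; left|by right; right].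
move=> a b [Ca|[->|->]] [Cb|[->|->]] p.
- by move=> Ip; left; apply: hull_convex Ip.
- by rewrite intervalC //; apply: endx.
- by rewrite intervalC //; apply: endu.
- exact: endx.
- by move=> /(interval_xx e_conn) ->; right; left.
- exact: Ixu.
- exact: endu.
- by rewrite intervalC //; apply: Ixu.
- by move=> /(interval_xx e_conn) ->; right; right.
Qed.

Lemma hull_neighbor_interval x u : hull_neighbors_between x u.
Proof.
move: {2}_.+1 (ltnSn (d x u)) => n.
elim: n x u => // n IHn x u lt_n v uv hv.
have IH y t : d y t < d x u -> hull_neighbors_between y t.
  by move=> lt_d; apply: IHn; apply: leq_trans lt_d _.
have [//|nIv] := pselect (interval e x u v).
have [Cv|[vx|vu]] := hull_sub_interior IH hv.
- case: (@point_shadowN v u); first by rewrite e_sym.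
  exact: (hull_interior_shadow (fun z => IH z u) uv hv nIv).
- by case: nIv; rewrite vx /interval /= distxx.
- by case: (edge_neq e_irr uv).
Qed.

End Shadows.

Theorem lemma13 (V : Type) (e : rel V)
  (e_sym : symmetric e) (e_irr : irreflexive e)
  (e_conn : graph_connected e)
  (shadow_convex : forall u v : V, e u v ->
     geodesically_convex e (point_shadow e v u)) :
  smooth e.
Proof.
move=> u v w x y [Iuwv Nuv] [Iuyv _] [Iwyx _].
have uv : e u v := edge_dist1 e_conn Nuv.
have IC := intervalC e_conn e_sym e_irr.
rewrite IC in Iuwv; rewrite IC in Iuyv.
have hw : point_shadow e v u w by apply: interval_hull.
have hy : point_shadow e v u y by apply: interval_hull.
have hx : point_shadow e v u x := shadow_convex u v uv w y hw hy x Iwyx.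
split=> //; rewrite IC.
exact: (hull_neighbor_interval e_sym e_irr e_conn shadow_convex uv hx).
Qed.
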